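(* Let $\mathbf K:X\times X\to\mathcal L(\mathcal B_p,\mathcal B_q)$ satisfy (A1), (A2) and (A3), and let $\mathbf x=\{x_1,\dots,x_m\}\subseteq X$ be pairwise distinct. Suppose there exists $\beta_m\ge1$ such that for all $\mathbf y\in\mathcal B_q^m$ $$\min_{f\in\mathcal I_{\mathbf x}(\mathbf y)}\|f\|_{\mathcal B_{\mathbf K}}\ \ge\ \frac1{\beta_m}\min_{f\in\mathcal I_{\mathbf x}(\mathbf y)\cap\mathcal S^{\mathbf x}}\|f\|_{\mathcal B_{\mathbf K}}.$$ Then the relaxed linear representer theorem holds for any completely continuous loss function $L$ and any regularization parameter $\lambda>0$, that is, for all $\mathbf y\in\mathcal B_q^m$, $$\min_{f\in\mathcal S^{\mathbf x}}\big\{L(f(\mathbf x),\mathbf y)+\lambda\|f\|_{\mathcal B_{\mathbf K}}\big\}\ \le\ \min_{f\in\mathcal B_{\mathbf K}}\big\{L(f(\mathbf x),\mathbf y)+\lambda\beta_m\|f\|_{\mathcal B_{\mathbf K}}\big\}.$$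
   Context: Let $p\in[1,+\infty]$ and $1/p+1/q=1$. $\mathcal B_p$ denotes the complex sequence space $\ell^2$ if $p=2$ and $(\mathbb C^n,\|\cdot\|_p)$ (fixed $n$) if $p\ne2$; $\mathcal B_q$ is defined in the same way from $q$. $\mathcal L(\mathcal B_p,\mathcal B_q)$ is the space of bounded linear operators with the operator norm. $X$ is a nonempty set. For pairwise distinct $\mathbf x=\{x_1,\dots,x_m\}\subseteq X$, $\mathbf K[\mathbf x]$ is the $m\times m$ operator matrix with $(k,i)$ entry $\mathbf K(x_i,x_k)$, so that $\mathbf K[\mathbf x]\mathbf c=(\sum_i\mathbf K(x_i,x_k)c_i)_k$. Assumptions on $\mathbf K$: (A1) for all $m$ and pairwise distinct $\mathbf x=\{x_1,\dots,x_m\}$, $\mathbf K[\mathbf x]:\mathcal B_p^m\to\mathcal B_q^m$ has a two-sided inverse with entries in $\mathcal L(\mathcal B_q,\mathcal B_p)$. (A2) there is $\kappa>0$ with $\|\mathbf K(x,x')\|\le\kappa$ for all $x,x'\in X$. (A3) for any finite or countably infinite family of pairwise distinct $x_i\in X$ and $c_i\in\mathcal B_p$ with $\sum_i\|c_i\|_p<\infty$, if $\sum_i\mathbf K(x_i,x)c_i=0$ for all $x\in X$, then all $c_i=0$. $\mathcal B_{\mathbf K}$ is the Banach space of functions $X\to\mathcal B_q$ of the form $\sum_{x\in\operatorname{supp}C}\mathbf K(x,\cdot)c_x$, where $C=(c_x)_{x\in X}$ is a family in $\mathcal B_p$ with countable support and $\sum_x\|c_x\|_p<\infty$, with norm $\sum_x\|c_x\|_p$.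 $f(\mathbf x)=(f(x_1),\dots,f(x_m))^T$, $\mathcal S^{\mathbf x}=\{\sum_{j=1}^m\mathbf K(x_j,\cdot)c_j:c_j\in\mathcal B_p\}$ and $\mathcal I_{\mathbf x}(\mathbf y)=\{f\in\mathcal B_{\mathbf K}:f(\mathbf x)=\mathbf y\}$. A loss function is a map $L:\mathcal B_q^m\times\mathcal B_q^m\to\mathbb R_+$ with $L(\mathbf y,\mathbf y)=0$ for all $\mathbf y\in\mathcal B_q^m$; it is completely continuous if $L(z_k)\to L(z_0)$ whenever $z_k\to z_0$ weakly. A minimum whose attainment is not guaranteed is understood as an infimum. *)

(* Defs.v *)
From HB Require Import structures.
From mathcomp Require Import all_boot all_order all_algebra finmap.
From mathcomp Require Import complex.
From mathcomp Require Import all_classical all_reals all_analysis.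
From mathcomp Require Import ring.
From mathcomp Require summability.
Set Implicit Arguments.
Unset Strict Implicit.
Unset Printing Implicit Defensive.
Import Order.TTheory GRing.Theory Num.Theory.
Import numFieldNormedType.Exports.
Local Open Scope classical_set_scope.
Local Open Scope ring_scope.

(* Norms over R[i] take their values in R[i]; rnorm is the norm as a real. *)
Definition rnorm (R : realType) (V : normedZmodType R[i]) (v : V) : R :=
  complex.Re `|v|.

Section Modulus.
Variable R : realType.
Implicit Types z w : R[i].

Lemma rnormE z : rnorm z = ComplexField.Normc.normc z.
Proof. by case: z. Qed.

Lemma rnormK (V : normedZmodType R[i]) (v : V) : (rnorm v)%:C%C = `|v|.
Proof.
have : 0 <= `|v| by [].
by rewrite /rnorm; case: `|v| => a b; rewrite lecE/= => /andP[/eqP-> _].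
Qed.

Lemma rnorm_ge0 (V : normedZmodType R[i]) (v : V) : 0 <= rnorm v.
Proof. by have := normr_ge0 v; rewrite -rnormK ler0c. Qed.

Lemma rnormD (V : normedZmodType R[i]) (v w : V) :
  rnorm (v + w) <= rnorm v + rnorm w.
Proof. by rewrite -lecR rmorphD/= !rnormK ler_normD. Qed.

Lemma rnormM z w : rnorm (z * w) = rnorm z * rnorm w.
Proof. by rewrite !rnormE ComplexField.Normc.normcM. Qed.

Lemma rnorm_eq0 (V : normedZmodType R[i]) (v : V) : rnorm v = 0 -> v = 0.
Proof. by move=> v0; apply/normr0_eq0; rewrite -rnormK v0. Qed.

End Modulus.

Section LpNorm.
Variables (R : realType) (I : choiceType).
Implicit Types (p : \bar R) (u v : I -> R[i]).
Local Open Scope ereal_scope.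

(* Only used for 1 <= p, so that the value at -oo is irrelevant. *)
Definition lpnorm p u : \bar R :=
  match p with
  | r%:E => (\esum_(i in [set: I]) (rnorm (u i) `^ r)%:E) `^ r^-1
  | _ => ereal_sup (range (fun i => (rnorm (u i))%:E))
  end.

Lemma esum_leP (f : I -> R) (a : R) :
  (\esum_(i in [set: I]) (f i)%:E <= a%:E) <->
  (forall F : {fset I}, (\sum_(i <- F) f i <= a)%R).
Proof.
split => [h F|h].
  rewrite -lee_fin; apply: le_trans h; rewrite -sumEFin; apply: esum_ge.
  exists [set` F]; first by split => //; exact: finite_fset.
  by rewrite fsbig_finite ?finite_fset//= set_fsetK.
apply: ge_ereal_sup => _ [X [Xf _] <-].
by rewrite fsbig_finite//= sumEFin lee_fin.
Qed.

Lemma lpnorm_ryP (r : R) u (a : R) : (1 <= r)%R -> (0 <= a)%R ->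
  (lpnorm r%:E u <= a%:E) <->
  (forall F : {fset I}, (\sum_(i <- F) rnorm (u i) `^ r <= a `^ r)%R).
Proof.
move=> r1 a0; have r0 : (0 < r)%R by rewrite (lt_le_trans _ r1).
rewrite -esum_leP /=.
have S0 : 0 <= \esum_(i in [set: I]) (rnorm (u i) `^ r)%:E.
  by apply: esum_ge0 => i _; rewrite lee_fin powR_ge0.
split => h.
- have := @gt0_ler_poweR _ r (ltW r0) _ _ _ _ h.
  rewrite -poweRrM mulVf ?gt_eqF// poweRe1// poweR_EFin; apply.
    by rewrite in_itv/= poweR_ge0 leey.
  by rewrite in_itv/= lee_fin a0 leey.
- have := @gt0_ler_poweR _ r^-1 _ _ _ _ _ h.
  rewrite poweR_EFin -powRrM mulfV ?gt_eqF// powRr1//; apply.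
  + by rewrite invr_ge0 ltW.
  + by rewrite in_itv/= S0 leey.
  + by rewrite in_itv/= lee_fin powR_ge0 leey.
Qed.

Lemma lpnorm_yP u (a : R) :
  (lpnorm +oo u <= a%:E) <-> (forall i, (rnorm (u i) <= a)%R).
Proof.
split => [h i|h].
  by rewrite -lee_fin; apply: le_trans h; apply: ereal_sup_ubound; exists i.
by apply: ge_ereal_sup => _ [i _ <-]; rewrite lee_fin.
Qed.

Lemma lpnorm_leD p u v (a b : R) : 1 <= p -> (0 < a)%R -> (0 < b)%R ->
  lpnorm p u <= a%:E -> lpnorm p v <= b%:E ->
  lpnorm p (u + v)%R <= (a + b)%:E.
Proof.
case: p => [r|_|//].
- rewrite lee_fin => r1 a0 b0.
  have ab0 : (0 < a + b)%R by rewrite addr_gt0.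
  have r0 : (0 < r)%R by rewrite (lt_le_trans _ r1).
  rewrite !lpnorm_ryP ?(ltW a0) ?(ltW b0) ?(ltW ab0)// => hu hv F.
  pose t := (a / (a + b))%R.
  have t01 : (0 <= t <= 1)%R.
    by rewrite /t divr_ge0 ?(ltW a0) ?(ltW ab0)//= ler_pdivrMr// mul1r lerDl ltW.
  have tE : (1 - t = b / (a + b))%R.
    by rewrite /t -[1%R](@mulfV _ (a + b)%R) ?gt_eqF// -mulrBl addrC addrA addNr add0r.
  have key i : (rnorm ((u + v)%R i) `^ r <= (a + b) `^ r *
      (t * (rnorm (u i) `^ r / a `^ r) + (1 - t) * (rnorm (v i) `^ r / b `^ r)))%R.
    have in0y (x c : R) : (0 <= x)%R -> (0 < c)%R ->
        (x / c)%R \in (`[0%R, +oo[%classic : set R).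
      by move=> x0 c0; rewrite inE/= in_itv/= divr_ge0 ?(ltW c0).
    have cvx : ((t * (rnorm (u i) / a) + (1 - t) * (rnorm (v i) / b)) `^ r <=
        t * (rnorm (u i) / a) `^ r + (1 - t) * (rnorm (v i) / b) `^ r)%R.
      exact: (convex_powR r1 (Itv01 (andP t01).1 (andP t01).2)
        (in0y _ _ (rnorm_ge0 (u i)) a0) (in0y _ _ (rnorm_ge0 (v i)) b0)).
    move: cvx.
    have dv (x c : R) : (0 <= x)%R -> (0 < c)%R ->
        ((x / c) `^ r = x `^ r / c `^ r)%R.
      by move=> x0 c0; rewrite powRM ?invr_ge0 ?(ltW c0)// -powR_inv1 ?(ltW c0)//
         powRAC powR_inv1 ?powR_ge0.
    rewrite !dv ?rnorm_ge0// => cvx.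
    apply: (@le_trans _ _ ((a + b) `^ r *
      ((t * (rnorm (u i) / a) + (1 - t) * (rnorm (v i) / b)) `^ r))%R); last first.
      by rewrite ler_pM2l ?powR_gt0.
    have w0 : (0 <= t * (rnorm (u i) / a) + (1 - t) * (rnorm (v i) / b))%R.
      apply: addr_ge0; apply: mulr_ge0; rewrite ?subr_ge0 ?(andP t01).1 ?(andP t01).2//.
        by rewrite divr_ge0 ?rnorm_ge0 ?(ltW a0).
      by rewrite divr_ge0 ?rnorm_ge0 ?(ltW b0).
    rewrite -powRM ?(ltW ab0)// ge0_ler_powR ?nnegrE ?rnorm_ge0 ?(ltW r0)//.
      by rewrite mulr_ge0 ?(ltW ab0).
    rewrite tE /t.
    rewrite [leRHS](_ : _ = rnorm (u i) + rnorm (v i))%R; last first.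
      by field; rewrite !gt_eqF.
    exact: rnormD.
  apply: (@le_trans _ _ (\sum_(i <- F) _)%R).
    by apply: ler_sum => i _; exact: key.
  rewrite -mulr_sumr big_split/= -!mulr_sumr -!mulr_suml.
  rewrite ler_piMr ?powR_ge0// -[leRHS](subrK t) addrC.
  have le1 (x c : R) : (0 < c)%R -> (x <= c `^ r -> x / c `^ r <= 1)%R.
    by move=> c0 xc; rewrite ler_pdivrMr ?powR_gt0// mul1r.
  apply: lerD; rewrite ler_piMr ?le1 ?(andP t01).1// subr_ge0.
  exact: (andP t01).2.
- move=> a0 b0; rewrite !lpnorm_yP => hu hv i.
  by apply: le_trans (rnormD _ _) _; exact: lerD.
Qed.

Lemma lpnorm_leZ p u (l : R[i]) (a : R) : 1 <= p -> (0 <= a)%R ->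
  lpnorm p u <= a%:E -> lpnorm p (l *: (u : I -> R[i]^o)) <= (rnorm l * a)%:E.
Proof.
case: p => [r|_|//].
- rewrite lee_fin => r1 a0.
  rewrite !lpnorm_ryP ?mulr_ge0 ?rnorm_ge0// => hu F.
  rewrite powRM ?rnorm_ge0//.
  under eq_bigr do rewrite /GRing.scale/= rnormM powRM ?rnorm_ge0//.
  by rewrite -mulr_sumr ler_wpM2l ?powR_ge0.
- move=> a0; rewrite !lpnorm_yP => hu i.
  by rewrite /GRing.scale/= rnormM ler_wpM2l ?rnorm_ge0.
Qed.

Lemma lpnorm_le0 p u : 1 <= p -> lpnorm p u <= 0%:E -> u = 0%R.
Proof.
case: p => [r|_|//].
- rewrite lee_fin => r1; rewrite lpnorm_ryP// => hu.
  have r0 : r != 0%R by rewrite gt_eqF// (lt_le_trans _ r1).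
  apply/funext => i; apply: rnorm_eq0; have := hu [fset i]%fset.
  rewrite big_seq_fset1 powR0// => h; apply/eqP.
  have : (rnorm (u i) `^ r == 0)%R by rewrite eq_le h powR_ge0.
  by rewrite powR_eq0 => /andP[].
- rewrite lpnorm_yP => hu; apply/funext => i; apply: rnorm_eq0.
  by apply/le_anti; rewrite hu rnorm_ge0.
Qed.

End LpNorm.

Section Lp.
Variables (R : realType) (I : choiceType) (p : \bar R).
Variable p1 : (1 <= p)%E.
Implicit Types u v : I -> R[i]^o.

(* p1 is a dummy argument, which lets the closure instance below be inferred. *)
Definition lp_pred of (1 <= p)%E : {pred I -> R[i]^o} :=
  mem [set u : I -> R[i]^o | (lpnorm p u < +oo)%E].

Lemma lpnorm_ge0 u (i : I) : (0 <= lpnorm p u)%E.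
Proof.
case: p p1 => [r _|_|//] /=; first exact: poweR_ge0.
apply: (@le_trans _ _ (rnorm (u i))%:E); first by rewrite lee_fin rnorm_ge0.
by apply: ereal_sup_ubound; exists i.
Qed.

Lemma lp_predP u : u \in lp_pred p1 <->
  exists2 a : R, 0 < a & (lpnorm p u <= a%:E)%E.
Proof.
rewrite inE/=; split => [|[a _] /le_lt_trans]; last by apply; exact: ltry.
case: (lpnorm p u) => [a _|//|_]; last by exists 1 => //; exact: leNye.
exists (`|a| + 1); first by rewrite ltr_wpDl.
by rewrite lee_fin (le_trans (ler_norm a))// lerDl.
Qed.

Lemma lp_pred_submod_closed : submod_closed (lp_pred p1).
Proof.
split.
  apply/lp_predP; exists 1 => //.
  case: p p1 => [r r1|_|//].
    rewrite lpnorm_ryP// => F; rewrite big1 ?powR_ge0// => i _.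
    rewrite rnormE/= expr0n/= addr0 sqrtr0 powR0// gt_eqF//.
    by rewrite lee_fin in r1; rewrite (lt_le_trans _ r1).
  by rewrite lpnorm_yP => i; rewrite rnormE/= expr0n/= addr0 sqrtr0.
move=> l u v /lp_predP[a a0 ua] /lp_predP[b b0 vb]; apply/lp_predP.
exists ((rnorm l * a + 1) + b).
  by rewrite addr_gt0// ltr_wpDl// mulr_ge0 ?rnorm_ge0// ltW.
apply: lpnorm_leD => //; first by rewrite ltr_wpDl// mulr_ge0 ?rnorm_ge0// ltW.
apply: (le_trans (lpnorm_leZ l p1 (ltW a0) ua)).
by rewrite lee_fin lerDl.
Qed.

HB.instance Definition _ :=
  GRing.isSubmodClosed.Build _ _ (lp_pred p1) lp_pred_submod_closed.

End Lp.

(* The space l^p(I) of families of complex numbers with finite p-norm. *)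
Record lp (R : realType) (I : choiceType) (p : \bar R) (p1 : (1 <= p)%E) := Lp {
  lpval :> I -> R[i]^o;
  lpvalP : lpval \in lp_pred p1 }.

Section LpSpace.
Variables (R : realType) (I : choiceType) (p : \bar R) (p1 : (1 <= p)%E).
Notation lp := (lp I p1).

HB.instance Definition _ := [isSub for @lpval R I p p1].
HB.instance Definition _ := [Choice of lp by <:].
HB.instance Definition _ := [SubChoice_isSubLmodule of lp by <:].

Implicit Types u v : lp.

Definition lpnormr u : R := fine (lpnorm p u).

Lemma lpnormr_ge0 u : 0 <= lpnormr u.
Proof.
rewrite /lpnormr; case: (pselect (exists i : I, True)) => [[i _]|I0].
  by rewrite fine_ge0// (lpnorm_ge0 p1 _ i).
move: (lpval u) => w; case: p p1 => [r r1|_|//].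
  by rewrite fine_ge0//= poweR_ge0.
have R0 : range (fun i => (rnorm (w i))%:E) = set0.
  by apply: contrapT => /eqP/set0P[x [i _ _]]; apply: I0; exists i.
by rewrite /lpnorm R0 ereal_sup0.
Qed.

Lemma lpnormr_leP u (a : R) : 0 <= a ->
  (lpnormr u <= a) <-> (lpnorm p u <= a%:E)%E.
Proof.
move=> a0; have := lpvalP u; rewrite inE /lpnormr/=.
by case: (lpnorm p u) => [r _|//|_]; [rewrite lee_fin|rewrite leNye].
Qed.

Lemma lpnormrD u v : lpnormr (u + v) <= lpnormr u + lpnormr v.
Proof.
apply/ler_addgt0Pr => e e0.
have pos w : 0 < lpnormr w + e / 2.
  by rewrite ltr_wpDl ?lpnormr_ge0// divr_gt0.
have le (w : lp) : (lpnorm p w <= (lpnormr w + e / 2)%:E)%E.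
  by apply/lpnormr_leP; rewrite ?lerDl ?divr_ge0 ?ltW ?pos.
rewrite [leRHS](_ : _ = (lpnormr u + e / 2) + (lpnormr v + e / 2)); last by field.
apply/lpnormr_leP; first by rewrite addr_ge0// ltW.
exact: (lpnorm_leD p1 (pos u) (pos v) (le u) (le v)).
Qed.

Lemma lpnormrZ (l : R[i]) u : lpnormr (l *: u) = rnorm l * lpnormr u.
Proof.
have le (k : R[i]) w : lpnormr (k *: w) <= rnorm k * lpnormr w.
  apply/lpnormr_leP; first by rewrite mulr_ge0 ?rnorm_ge0 ?lpnormr_ge0.
  by apply: lpnorm_leZ; rewrite ?lpnormr_ge0//; apply/lpnormr_leP;
    rewrite ?lpnormr_ge0.
apply/le_anti; rewrite le/=; have [->|l0] := eqVneq l 0.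
  by rewrite [rnorm 0]rnormE/= expr0n/= addr0 sqrtr0 mul0r lpnormr_ge0.
have nl0 : 0 < rnorm l.
  by rewrite lt_def rnorm_ge0 andbT; apply: contra l0 => /eqP/rnorm_eq0 ->.
rewrite -ler_pdivlMl//; have := le l^-1 (l *: u).
by rewrite scalerA mulVf// scale1r rnormE ComplexField.Normc.normcV -rnormE.
Qed.

Lemma lpnormr_eq0 u : lpnormr u = 0 -> u = 0.
Proof.
move=> u0; apply/val_inj/(lpnorm_le0 p1).
by apply/lpnormr_leP; rewrite ?u0.
Qed.

Let nm u : R[i] := (lpnormr u)%:C%C.

Let nmD u v : nm (u + v) <= nm u + nm v.
Proof. by rewrite -rmorphD lecR lpnormrD. Qed.

Let nmZ (l : R[i]) u : nm (l *: u) = `|l| * nm u.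
Proof. by rewrite /nm lpnormrZ rmorphM/= rnormK. Qed.

Let nm_eq0 u : nm u = 0 -> u = 0.
Proof. by move=> /(congr1 (@complex.Re R))/= /lpnormr_eq0. Qed.

HB.instance Definition _ := Lmodule_isNormed.Build R[i] lp nmD nmZ nm_eq0.

Lemma lp_rnormE u : rnorm u = fine (lpnorm p u).
Proof. by []. Qed.

End LpSpace.

(* l^2 if p = 2 and C^n with the p-norm otherwise; over the finite index type
   'I_n the finiteness condition in lp always holds. *)
Definition calB_index (R : realType) (p : \bar R) (n : nat) : countType :=
  if p == 2%:E then (nat : countType) else ('I_n : countType).

Definition calB (R : realType) (n : nat) (p : \bar R) (p1 : (1 <= p)%E) :
  normedModType R[i] := lp (calB_index p n) p1.

Section BoundedOperators.
Variables (R : realType) (V W : normedModType R[i]).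

Record bounded_op := BoundedOp {
  bop_val :> {linear V -> W};
  bop_bounded : exists M : R, forall v, rnorm (bop_val v) <= M * rnorm v }.

Definition opnorm (T : bounded_op) : R :=
  sup [set rnorm (T v) | v in [set v : V | rnorm v <= 1]].

Definition opmx_app (m : nat) (A : 'I_m -> 'I_m -> bounded_op)
    (c : 'I_m -> V) : 'I_m -> W := fun k => \sum_(i < m) A k i (c i).

End BoundedOperators.

(* Unconditional summation, i.e. convergence of the net of finite partial
   sums; every family summed below is absolutely summable. *)
Definition has_sum (R : realType) (I : choiceType) (V : normedModType R[i])
    (u : I -> V) (s : V) : Prop :=
  (\sum_(i <- F) u i) @[F --> @summability.totally I] --> s.

Section VectorValuedRKBS.
Variables (R : realType) (X : pointedType) (V W : normedModType R[i]).
Variable K : X -> X -> bounded_op V W.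

Definition kernel_mx (m : nat) (x : 'I_m -> X) : 'I_m -> 'I_m -> bounded_op V W :=
  fun k i => K (x i) (x k).

Definition A1 : Prop :=
  forall (m : nat) (x : 'I_m -> X), injective x ->
  exists M : 'I_m -> 'I_m -> bounded_op W V,
    cancel (opmx_app (kernel_mx x)) (opmx_app M) /\
    cancel (opmx_app M) (opmx_app (kernel_mx x)).

Definition A2 : Prop :=
  exists2 kappa : R, 0 < kappa & forall x x', opnorm (K x x') <= kappa.

(* A finite or countably infinite family is one indexed by a countType. *)
Definition A3 : Prop :=
  forall (J : countType) (x : J -> X) (c : J -> V), injective x ->
    (\esum_(j in [set: J]) (rnorm (c j))%:E < +oo)%E ->
    (forall t, has_sum (fun j => K (x j) t (c j)) 0) ->
    forall j, c j = 0.

Definition represents (c : X -> V) (f : X -> W) : Prop :=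
  [/\ countable [set x | c x != 0],
      (\esum_(x in [set: X]) (rnorm (c x))%:E < +oo)%E &
      forall t, has_sum (fun x => K x t (c x)) (f t)].

Definition BK : set (X -> W) := [set f | exists c, represents c f].

(* Under A3 the representing family is unique. *)
Definition BKcoef (f : X -> W) : X -> V :=
  xget (fun=> 0) [set c | represents c f].

Definition BKnorm (f : X -> W) : R :=
  fine (\esum_(x in [set: X]) (rnorm (BKcoef f x))%:E)%E.

Definition sample (m : nat) (x : 'I_m -> X) (f : X -> W) : 'I_m -> W :=
  fun k => f (x k).

Definition span_at (m : nat) (x : 'I_m -> X) : set (X -> W) :=
  [set f | exists c : 'I_m -> V, f = fun t => \sum_(j < m) K (x j) t (c j)].

Definition interpolants (m : nat) (x : 'I_m -> X) (y : 'I_m -> W) :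
  set (X -> W) := [set f | BK f /\ sample x f = y].

Definition inf_norm (A : set (X -> W)) : \bar R :=
  ereal_inf [set (BKnorm f)%:E | f in A].

End VectorValuedRKBS.

Section Loss.
Variables (R : realType) (m : nat) (W : normedModType R[i]).
Notation Wm := ('I_m -> W).

(* Boundedness on W^m x W^m does not depend on the choice of a product norm. *)
Definition bounded_functional (phi : {linear (Wm * Wm)%type -> R[i]^o}) : Prop :=
  exists M : R, forall z, rnorm (phi z) <=
    M * (\sum_(i < m) rnorm (z.1 i) + \sum_(i < m) rnorm (z.2 i)).

Definition weakly_converges (z : nat -> (Wm * Wm)%type) (z0 : (Wm * Wm)%type) : Prop :=
  forall phi : {linear (Wm * Wm)%type -> R[i]^o}, bounded_functional phi ->
    phi (z k) @[k --> \oo] --> phi z0.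

Definition is_loss (L : (Wm * Wm)%type -> R) : Prop :=
  (forall z, 0 <= L z) /\ (forall y, L (y, y) = 0).

Definition completely_continuous (L : (Wm * Wm)%type -> R) : Prop :=
  forall (z : nat -> (Wm * Wm)%type) (z0 : (Wm * Wm)%type), weakly_converges z z0 ->
    L (z k) @[k --> \oo] --> L z0.

End Loss.

Definition objective (R : realType) (X : pointedType) (V W : normedModType R[i])
    (K : X -> X -> bounded_op V W) (m : nat) (x : 'I_m -> X)
    (L : ('I_m -> W) * ('I_m -> W) -> R) (y : 'I_m -> W) (mu : R)
    (f : X -> W) : R :=
  L (sample x f, y) + mu * BKnorm K f.

(* Main.v *)
Require Import Defs.
From HB Require Import structures.
From mathcomp Require Import all_boot all_order all_algebra.
From mathcomp Require Import finmap.
From mathcomp Require Import complex.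
From mathcomp Require Import all_classical all_reals all_analysis.
From mathcomp Require Import lra.
From mathcomp Require summability.
Set Implicit Arguments.
Unset Strict Implicit.
Unset Printing Implicit Defensive.
Import Order.TTheory GRing.Theory Num.Theory.
Import numFieldNormedType.Exports.
Local Open Scope classical_set_scope.
Local Open Scope ring_scope.

(* By A3 the norm of [sum_j K(x_j, .) c_j] in B_K is [sum_j |c_j|], so on the
   span of the kernel sections the objective is a function of the coefficients
   [c]. A minimizing sequence of coefficients is bounded; a compactness
   argument on coordinates gives a subsequence converging coordinatewise, hence
   weakly, as bounded functionals on l^2 are uniformly small on vectors
   supported far out. The loss passes to the limit by complete continuity and
   the norms are lower semicontinuous, so the limit is a minimizer. For the
   inequality, A1 gives exactly one interpolant of [f(x)] in the span, and its
   norm is at most [beta |f|] by the assumption on the minimal interpolants. *)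

(** * Subsequences *)

Lemma cvg_powR (R : realType) (u : nat -> R) (l r : R) : 0 < r ->
  (forall k, 0 <= u k) -> u k @[k --> \oo] --> l ->
  u k `^ r @[k --> \oo] --> l `^ r.
Proof.
move=> r0 u0 ul.
have l0 : 0 <= l.
  by rewrite -(cvg_lim _ ul)//; apply: limr_ge; [apply: cvgP ul|exact: nearW].
move: l0; rewrite le_eqVlt => /orP[/eqP l0|l0].
  rewrite -l0 powR0 ?gt_eqF//; rewrite -l0 in ul.
  apply/cvgr0Pnorm_lt => e e0.
  have e1 : 0 < e `^ r^-1 by rewrite powR_gt0.
  have /cvgr0Pnorm_lt/(_ _ e1) := ul.
  apply: filterS => k; rewrite !ger0_norm ?powR_ge0// => uk.
  rewrite -[ltRHS]powRr1 ?(ltW e0)// -(mulVf (lt0r_neq0 r0)) powRrM.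
  by rewrite gt0_ltr_powR ?nnegrE ?powR_ge0.
apply: (cvg_comp u (fun z => z `^ r) ul).
have [+ _] := is_derive1_powR r l0.
by move=> /derivable1_diffP/differentiable_continuous.
Qed.

(* By Tychonoff the sequence has a cluster point for the product topology; as
   [T] is countable, the k-th index can be chosen so that the first k
   coordinates are within 1/(k+1) of it. *)
Lemma pointwise_bounded_subsequence (R : realType) (T : countType) (B : T -> R)
    (u : nat -> T -> R) : (forall k t, `|u k t| <= B t) ->
  exists (s : nat -> nat) (l : T -> R), (forall k, (k <= s k)%N) /\
    forall t, u (s k) t @[k --> \oo] --> l t.
Proof.
move=> uB.
have cpt : forall t : T, compact (`[- B t, B t]%classic : set R).
  by move=> t; exact: segment_compact.
have [|l [_ lcl]] := @tychonoff T (fun=> R) _ cpt (u @ \oo) _.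
  by exists 0%N => // k _ t /=; rewrite in_itv/= -ler_norml.
(* Only these three properties of the neighbourhood filter of the cluster point are used below; the
   product topology does not appear again. *)
have [F [FF coordF meetF]] : exists F : set_system (T -> R), [/\ Filter F,
    forall (e : R) (t : T), 0 < e -> F [set f | `|l t - f t| < e] &
    forall A N, F A -> exists2 k, (N <= k)%N & A (u k)].
  exists (nbhs (l : prod_topology (fun _ : T => R))); split.
  - exact: (nbhs_filter (l : prod_topology (fun _ : T => R))).
  - move=> e t e0.
    apply: (@proj_continuous T (fun=> R) t l [set z | `|l t - z| < e]).
    by apply/nbhs_ballP; exists e.
  - move=> A N lA.
    have [|_ [[k Nk <-] Ak]] := lcl (u @` [set k | (N <= k)%N]) A _ lA.
      by exists N => // k Nk; exists k.
    by exists k.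
pose near_l (N : nat) : set (T -> R) :=
  [set f | forall t : T, (choice.pickle t < N)%N -> `|l t - f t| < N.+1%:R^-1].
have F_near N : F (near_l N).
  have : 0 < (N.+1%:R^-1 : R) by [].
  (* Freeing the tolerance from [N] lets the induction add one coordinate condition at a time. *)
  rewrite /near_l; move: (N.+1%:R^-1 : R) => e e0.
  elim: N => [|N IH]; first by apply: (filterS _ filterT).
  case E : (pickle_inv N : option T) => [t0|].
    apply: filterS (filterI IH (coordF e t0 e0)) => f [fN ft0] t.
    rewrite ltnS leq_eqVlt => /orP[/eqP tN|]; last exact: fN.
    by move: E; rewrite -tN pickleK_inv => -[->].
  apply: filterS IH => f fN t; rewrite ltnS leq_eqVlt => /orP[/eqP tN|].
    by move: E; rewrite -tN pickleK_inv.
  exact: fN.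
have ex N : exists k, (N <= k)%N /\ near_l N (u k).
  by have [k Nk lk] := meetF _ N (F_near N); exists k.
have [s sP] := choice ex; exists s, l; split => [k|t]; first by case: (sP k).
apply/cvgrPdist_lt => e e0.
near=> k; apply: (lt_trans ((sP k).2 t _)).
  by near: k; exact: nbhs_infty_gt.
by near: k; exact: near_infty_natSinv_lt (PosNum e0).
Unshelve. all: by end_near.
Qed.

(** * Real-valued norms and small tails *)

Section ComplexSequences.
Variable R : realType.
Implicit Types z w : R[i].

Lemma rnorm0 (V : normedZmodType R[i]) : rnorm (0 : V) = 0.
Proof. by rewrite /rnorm normr0. Qed.

Lemma rnormN (V : normedZmodType R[i]) (v : V) : rnorm (- v) = rnorm v.
Proof. by rewrite /rnorm normrN. Qed.

Lemma rnorm_dist (V : normedZmodType R[i]) (v w : V) :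
  `|rnorm v - rnorm w| <= rnorm (v - w).
Proof.
have le a b : rnorm a - rnorm b <= rnorm (a - b).
  by rewrite lerBlDr (le_trans _ (rnormD _ _))// subrK.
by rewrite ler_norml le andbT lerNl opprB -(rnormN (v - w)) opprB le.
Qed.

Lemma rnorm_sum (V : normedZmodType R[i]) (I : Type) (s : seq I) (P : pred I)
    (f : I -> V) :
  rnorm (\sum_(i <- s | P i) f i) <= \sum_(i <- s | P i) rnorm (f i).
Proof.
elim/big_ind2 : _ => [|x1 x2 y1 y2 h1 h2|//]; first by rewrite rnorm0.
by rewrite (le_trans (rnormD _ _))// lerD.
Qed.

Lemma rnorm_le_ReIm z : rnorm z <= `|complex.Re z| + `|complex.Im z|.
Proof.
rewrite rnormE; case: z => a b /=.
rewrite -[leRHS]ger0_norm ?addr_ge0// -sqrtr_sqr ler_wsqrtr// sqrrD.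
by rewrite !real_normK ?num_real// lerD2r lerDl mulrn_wge0// mulr_ge0.
Qed.

Lemma ReIm_le_rnorm z :
  `|complex.Re z| <= rnorm z /\ `|complex.Im z| <= rnorm z.
Proof.
rewrite rnormE; case: z => a b /=.
by split; rewrite -sqrtr_sqr ler_wsqrtr// (lerDl, lerDr) sqr_ge0.
Qed.

Lemma cvg_rnorm_ReIm (u : nat -> R[i]) (l : R[i]) :
  complex.Re (u k) @[k --> \oo] --> complex.Re l ->
  complex.Im (u k) @[k --> \oo] --> complex.Im l ->
  rnorm (u k - l) @[k --> \oo] --> (0 : R).
Proof.
move=> ure uim.
have dist0 (v : nat -> R) (a : R) : v k @[k --> \oo] --> a ->
    `|v k - a| @[k --> \oo] --> (0 : R).
  move=> va; rewrite -(normr0 R) -(subrr a); apply: cvg_norm.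
  by apply: cvgB => //; exact: cvg_cst.
have lim0 : `|complex.Re (u k) - complex.Re l| +
    `|complex.Im (u k) - complex.Im l| @[k --> \oo] --> (0 : R).
  rewrite -[X in _ --> X](addr0 (0 : R)); apply: cvgD.
  - exact: dist0 ure.
  - exact: dist0 uim.
apply: (squeeze_cvgr _ (cvg_cst 0) lim0).
apply: nearW => k; rewrite rnorm_ge0/=; apply: le_trans (rnorm_le_ReIm _) _.
by case: (u k) (l) => a b [c d].
Qed.

Lemma cvg_rnorm (V : normedZmodType R[i]) (u : nat -> V) (l : V) :
  rnorm (u k - l) @[k --> \oo] --> (0 : R) ->
  rnorm (u k) @[k --> \oo] --> rnorm l.
Proof.
move=> ul; apply/cvgrPdist_lt => e e0; have /cvgr0Pnorm_lt/(_ _ e0) := ul.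
apply: filterS => k; rewrite ger0_norm ?rnorm_ge0//; apply: le_lt_trans.
by rewrite distrC rnorm_dist.
Qed.

(** Take [S] whose sum is within [e] of the supremum of all finite sums: a disjoint [F] contributing
    more than [e] would push the union above that supremum. *)
Lemma small_tail (I : choiceType) (f : I -> R) (B : R) :
  (forall F : {fset I}, \sum_(i <- F) f i <= B) ->
  forall e, 0 < e -> exists S : {fset I}, forall F : {fset I},
    [disjoint F & S]%fset -> \sum_(i <- F) f i <= e.
Proof.
move=> fB e e0; pose A := [set \sum_(i <- F) f i | F in [set: {fset I}]].
have supA : has_sup A.
  split; first by exists (\sum_(i <- fset0) f i); exists fset0.
  by exists B => _ [F _ <-].
have [_ [S _ <-] Se] := sup_adherent e0 supA.
exists S => F FS.
have : \sum_(i <- (F `|` S)%fset) f i <= sup A.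
  by apply: sup_upper_bound => //; exists (F `|` S)%fset.
rewrite (perm_big (F ++ S)) ?big_cat/=; first lra.
apply: uniq_perm => [||i]; rewrite ?fset_uniq// ?mem_cat ?inE//.
rewrite cat_uniq !fset_uniq/= andbT; apply/hasPn => i iS.
by move/fdisjointP_sym : FS; apply.
Qed.

End ComplexSequences.

(** * Weak convergence in l^p *)

Section LpCoordinates.
Variables (R : realType) (I : choiceType) (p : \bar R) (p1 : (1 <= p)%E).
Local Notation lp := (lp I p1).
Implicit Types u v : lp.

Lemma lpnorm_mono (u v : I -> R[i]) (a : R) : 0 <= a ->
  (forall i, rnorm (v i) <= rnorm (u i)) ->
  (lpnorm p u <= a%:E)%E -> (lpnorm p v <= a%:E)%E.
Proof.
move=> a0 vu; case: p p1 => [r|_|//].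
  rewrite lee_fin => r1; rewrite !lpnorm_ryP// => uF F.
  apply: le_trans (uF F); apply: ler_sum => i _.
  by rewrite ge0_ler_powR ?nnegrE ?rnorm_ge0// (le_trans _ r1).
by rewrite !lpnorm_yP => ua i; exact: le_trans (vu i) (ua i).
Qed.

Lemma rnorm_lp_mono u v : (forall i, rnorm (v i) <= rnorm (u i)) ->
  rnorm v <= rnorm u.
Proof.
move=> vu; apply/lpnormr_leP; first exact: rnorm_ge0.
apply: (lpnorm_mono _ vu); first exact: rnorm_ge0.
by apply/lpnormr_leP => //; exact: rnorm_ge0.
Qed.

(** A bound on [lpnorm] amounts to bounds on finite sums, or on single coordinates when [p = +oo],
    and these pass to the limit. Here [l] is a bare family, so the lemma can also show that a limit
    belongs to l^p. *)
Lemma lpnorm_lsc (u : nat -> I -> R[i]) (l : I -> R[i]) (a : nat -> R) (b : R) :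
  (forall k, 0 <= a k) -> (forall k, (lpnorm p (u k) <= (a k)%:E)%E) ->
  (forall i, rnorm (u k i) @[k --> \oo] --> rnorm (l i)) ->
  a k @[k --> \oo] --> b -> (lpnorm p l <= b%:E)%E.
Proof.
move=> a0 ua ul ab.
have b0 : 0 <= b.
  by rewrite -(cvg_lim _ ab)//; apply: limr_ge; [apply: cvgP ab|exact: nearW].
case: p p1 ua => [r|_|//].
  rewrite lee_fin => r1 ua; rewrite lpnorm_ryP// => F.
  have r0 : 0 < r by exact: lt_le_trans r1.
  have cF : \sum_(i <- F) rnorm (u k i) `^ r @[k --> \oo] -->
      \sum_(i <- F) rnorm (l i) `^ r.
    apply: cvg_big; [exact: add_continuous|move=> i _].
    by apply: cvg_powR => // k; exact: rnorm_ge0.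
  apply: (ler_cvg_to cF (cvg_powR r0 a0 ab)); apply: nearW => k.
  by move: (ua k); rewrite lpnorm_ryP.
move=> ua; rewrite lpnorm_yP => i.
apply: (ler_cvg_to (ul i) ab); apply: nearW => k.
by move: (ua k); rewrite lpnorm_yP.
Qed.

Lemma lp_lsc (u : nat -> lp) (l : lp) (b : R) :
  (forall i, rnorm (u k i - l i) @[k --> \oo] --> (0 : R)) ->
  rnorm (u k) @[k --> \oo] --> b -> rnorm l <= b.
Proof.
move=> ul ub.
have b0 : 0 <= b.
  rewrite -(cvg_lim _ ub)//; apply: limr_ge; [apply: cvgP ub|].
  by apply: nearW => k; exact: rnorm_ge0.
apply/lpnormr_leP => //.
apply: (@lpnorm_lsc (fun k => lpval (u k)) l (fun k => rnorm (u k)) b) => //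
  [k|k|i].
- exact: rnorm_ge0.
- by apply/lpnormr_leP => //; exact: rnorm_ge0.
- exact: cvg_rnorm.
Qed.

Let delta_fun (i : I) : I -> R[i]^o := fun j => (i == j)%:R.

Let delta_lp i : delta_fun i \in lp_pred p1.
Proof.
apply/lp_predP; exists 1 => //.
have d j : rnorm (delta_fun i j) = (i == j)%:R.
  by rewrite /delta_fun /rnorm; case: eqP; rewrite ?normr1 ?normr0.
case: p p1 => [r|_|//].
  rewrite lee_fin => r1; have r0 : 0 < r by exact: lt_le_trans r1.
  rewrite lpnorm_ryP// powR1 => F.
  under eq_bigr do rewrite d.
  have [iF|iF] := boolP (i \in F).
    rewrite (big_fsetD1 i)//= eqxx powR1 big1_fset ?addr0// => j.
    rewrite !inE => /andP[/negPf + _] _; rewrite eq_sym => ->.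
    by rewrite powR0 ?gt_eqF.
  rewrite big1_fset// => j jF _; case: eqP => [ij|_]; last first.
    by rewrite powR0 ?gt_eqF.
  by rewrite -ij (negPf iF) in jF.
by rewrite lpnorm_yP => j; rewrite d lern1 leq_b1.
Qed.

Definition lp_delta (i : I) : lp := Lp (delta_lp i).

(** The truncation of [a] to [S], written with unit vectors so that a linear map can be expanded on
    it. *)
Definition lp_comb (S : {fset I}) (a : I -> R[i]) : lp :=
  \sum_(i <- S) a i *: lp_delta i.

Lemma lp_combE S a j : lp_comb S a j = if j \in S then a j else 0.
Proof.
rewrite /lp_comb.
have -> : lpval (\sum_(i <- S) a i *: lp_delta i) j =
    \sum_(i <- S) a i * (i == j)%:R.
  by elim/big_ind2 : _ => // x1 x2 y1 y2 <- <-.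
case: ifPn => jS.
  rewrite (big_fsetD1 j)//= eqxx mulr1 big1_fset ?addr0// => i.
  by rewrite !inE => /andP[/negPf -> _] _; rewrite mulr0.
rewrite big1_fset// => i iS _; case: eqP => [ij|_]; last by rewrite mulr0.
by rewrite ij (negPf jS) in iS.
Qed.

End LpCoordinates.

(** * Bounded functionals on l^p *)

Section WeakConvergence.
Variables (R : realType) (I : choiceType) (p : \bar R) (p1 : (1 <= p)%E).
Local Notation lp := (lp I p1).
Variable psi : {linear lp -> R[i]^o}.
Variable M : R.
Hypothesis M0 : 0 <= M.
Hypothesis psiM : forall u, rnorm (psi u) <= M * rnorm u.

Lemma linear_lp_comb (S : {fset I}) (a : I -> R[i]) :
  psi (lp_comb p1 S a) = \sum_(i <- S) a i * psi (lp_delta p1 i).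
Proof. by rewrite linear_sum; apply: eq_bigr => i _; rewrite linearZ. Qed.

Lemma rnorm_lp2_sum (u : lp) (F : {fset I}) : p = 2%:E ->
  \sum_(i <- F) rnorm (u i) ^+ 2 <= rnorm u ^+ 2.
Proof.
move=> p2; have /lpnormr_leP := lexx (rnorm u).
move=> /(_ (rnorm_ge0 u)); have := rnorm_ge0 u.
move: (rnorm u) (lpval u) => a v a0; rewrite p2 lpnorm_ryP ?ler1n//.
move=> /(_ F); rewrite powR_mulrn//; apply: le_trans.
by under [leRHS]eq_bigr do rewrite powR_mulrn ?rnorm_ge0//.
Qed.

Lemma rnorm_lp2_le (u : lp) (a : R) : p = 2%:E -> 0 <= a ->
  (forall F : {fset I}, \sum_(i <- F) rnorm (u i) ^+ 2 <= a ^+ 2) ->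
  rnorm u <= a.
Proof.
move=> p2 a0 ua; apply/lpnormr_leP => //.
move: (lpval u) ua => v va; rewrite p2 lpnorm_ryP ?ler1n// => F.
rewrite powR_mulrn//; apply: le_trans (va F).
by under eq_bigr do rewrite powR_mulrn ?rnorm_ge0//.
Qed.

(** Testing [psi] on the finite vector whose entries are conjugate to its coefficients gives
    [s <= M * Num.sqrt s] for the sum [s] on the left, hence [s <= M ^+ 2]. *)
Lemma functional_coef_bound (F : {fset I}) : p = 2%:E ->
  \sum_(i <- F) rnorm (psi (lp_delta p1 i)) ^+ 2 <= M ^+ 2.
Proof.
move=> p2; set s := (X in X <= _).
have s0 : 0 <= s by apply: sumr_ge0 => i _; rewrite exprn_ge0 ?rnorm_ge0.
pose a i : R[i] := (psi (lp_delta p1 i))^*%C.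
have rnorma i : rnorm (a i) = rnorm (psi (lp_delta p1 i)).
  by rewrite /a !rnormE; case: (psi _) => c d /=; rewrite sqrrN.
have psia : psi (lp_comb p1 F a) = s%:C%C.
  rewrite linear_lp_comb rmorph_sum/=; apply: eq_bigr => i _.
  by rewrite mulrC -sqr_normc -rnormK rmorphXn.
have na : rnorm (lp_comb p1 F a) <= Num.sqrt s.
  apply: rnorm_lp2_le => // G; rewrite sqr_sqrtr//.
  (* The sum over [G] only sees indices in [F], where its terms are terms of [s]. *)
  rewrite (big_fsetID _ (mem F))/= [X in _ + X]big1_fset; last first.
    move=> i; rewrite !inE/= => /andP[_ /negPf iF] _.
    by rewrite lp_combE iF rnorm0 expr0n.
  rewrite addr0 /s (big_fsetID _ (mem G) F)/= -[leLHS]addr0 lerD//; last first.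
    by apply: sumr_ge0 => i _; rewrite exprn_ge0 ?rnorm_ge0.
  rewrite (_ : [fset i in G | i \in F]%fset = [fset i in F | i \in G]%fset).
    rewrite big_seq [leRHS]big_seq; apply: ler_sum => i.
    by rewrite !inE/= => /andP[iF _]; rewrite lp_combE iF rnorma.
  by apply/fsetP => i; rewrite !inE/= andbC.
have : s <= M * Num.sqrt s.
  have := psiM (lp_comb p1 F a); rewrite psia rnormE/= expr0n addr0.
  rewrite sqrtr_sqr ger0_norm// => /le_trans; apply.
  by rewrite ler_wpM2l.
move=> sM; have [sqM|Msq] := leP (Num.sqrt s) M.
  by rewrite -(sqr_sqrtr s0) lerXn2r ?nnegrE ?sqrtr_ge0.
have : M * Num.sqrt s < Num.sqrt s ^+ 2.
  by rewrite expr2 ltr_pM2r// (le_lt_trans M0).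
by rewrite sqr_sqrtr// ltNge sM.
Qed.

(* The coefficients [psi e_i] are square summable, so [a b <= b^2 / e + e a^2]
   bounds [psi] outside a finite set carrying almost all of their mass. *)
Lemma functional_small_tail : p = 2%:E -> forall e, 0 < e ->
  exists S : {fset I}, forall u : lp, (forall i, i \in S -> u i = 0) ->
    rnorm (psi u) <= e * (1 + rnorm u ^+ 2).
Proof.
move=> p2 e e0.
(* The mass left outside [S] is at most [e ^+ 2], because it is divided by [e] later. *)
have [S SP] := small_tail (fun F => functional_coef_bound F p2)
  (exprn_gt0 2 e0).
exists S => u uS; apply/ler_addgt0Pr => d d0.
(* Adding 1 keeps the denominator positive when [M = 0], and still [M * d' <= d]. *)
pose d' := d / (M + 1).
have M1 : 0 < M + 1 by rewrite ltr_wpDl.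
have d'0 : 0 < d' by rewrite divr_gt0.
have [F FP] := small_tail (fun G => rnorm_lp2_sum u G p2) (exprn_gt0 2 d'0).
(* Replacing [u] by its truncation to [F] costs at most [d] under [psi] and leaves a finite sum to
   estimate. *)
pose c := lp_comb p1 F u.
have uc : rnorm (u - c) <= d'.
  apply: rnorm_lp2_le => // [|G]; first exact: ltW.
  have ucE i : (u - c) i = if i \in F then 0 else u i.
    rewrite [LHS](_ : _ = u i - c i)// lp_combE.
    by case: ifP; rewrite ?subrr ?subr0.
  under eq_bigr do rewrite ucE.
  rewrite (big_fsetID _ (mem F))/= big1_fset ?add0r; last first.
    by move=> i; rewrite !inE/= => /andP[_ ->] _; rewrite rnorm0 expr0n.
  rewrite big_seq (eq_bigr (fun i => rnorm (u i) ^+ 2)) -?big_seq; last first.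
    by move=> i; rewrite !inE/= => /andP[_ /negPf ->].
  by apply: FP; apply/fdisjointP => i; rewrite !inE/= => /andP[].
rewrite -[u in psi u](subrK c) linearD (le_trans (rnormD _ _))// addrC lerD//.
  rewrite linear_lp_comb (big_fsetID _ (mem S))/= big1_fset ?add0r; last first.
    by move=> i; rewrite !inE/= => /andP[_ iS] _; rewrite uS ?mul0r.
  set G := [fset _ in F | _]%fset.
  have GS : [disjoint G & S]%fset.
    by apply/fdisjointP => i; rewrite !inE/= => /andP[].
  apply: (le_trans (rnorm_sum _ _ _)).
  apply: (@le_trans _ _ (\sum_(i <- G)
      (rnorm (psi (lp_delta p1 i)) ^+ 2 / e + e * rnorm (u i) ^+ 2))).
    apply: ler_sum => i _; rewrite rnormM.
    move: (rnorm_ge0 (u i)) (rnorm_ge0 (psi (lp_delta p1 i))).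
    move: (rnorm (u i)) (rnorm (psi _)) => a b a0 b0.
    rewrite -(@ler_pM2r _ e)// mulrDl divfK ?gt_eqF//; nra.
  rewrite big_split/= -mulr_suml -mulr_sumr mulrDr mulr1 lerD//.
    by rewrite ler_pdivrMr// -expr2 SP.
  by apply: ler_wpM2l; [exact: ltW|exact: rnorm_lp2_sum].
apply: (le_trans (psiM _)); apply: (@le_trans _ _ (M * d')).
  by rewrite ler_wpM2l.
by rewrite /d' mulrCA ger_pMr// ler_pdivrMr// mul1r lerDl.
Qed.

(** The part of [u k - l] on a finite set tends to 0 by coordinates, and the tail bound controls the
    rest uniformly in [k]. The alternative on [p] and [I] matters: in l^1 over an infinite set,
    distinct unit vectors tend to 0 by coordinates but not weakly. *)
Lemma lp_weak_cvg (u : nat -> lp) (l : lp) (C : R) :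
  (p = 2%:E \/ exists S : {fset I}, forall i, i \in S) ->
  (forall k, rnorm (u k) <= C) ->
  (forall i, rnorm (u k i - l i) @[k --> \oo] --> (0 : R)) ->
  rnorm (psi (u k) - psi l) @[k --> \oo] --> (0 : R).
Proof.
move=> pI uC ul.
have tail e : 0 < e -> exists S : {fset I},
    forall v : lp, (forall i, i \in S -> v i = 0) ->
      rnorm (psi v) <= e * (1 + rnorm v ^+ 2).
  case: pI => [p2 e0|[S IS] e0]; first exact: functional_small_tail.
  exists S => v vS; rewrite (_ : v = 0) ?linear0 ?rnorm0.
    by rewrite mulr_ge0 ?(ltW e0)// addr_ge0 ?sqr_ge0.
  by apply/val_inj/funext => i; exact: vS.
pose D := C + rnorm l.
have uD k : rnorm (u k - l) <= D.
  by rewrite (le_trans (rnormD _ _))// rnormN lerD2r.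
apply/cvgr0Pnorm_lt => e e0.
have D1 : 0 < 1 + D ^+ 2 by rewrite ltr_pwDl ?sqr_ge0.
(* With this tolerance a remainder of norm at most [D] contributes at most [e / 2]. *)
have [|S SP] := tail (e / 2 / (1 + D ^+ 2)); first by rewrite !divr_gt0.
have cS : \sum_(i <- S) rnorm (u k i - l i) * rnorm (psi (lp_delta p1 i))
    @[k --> \oo] --> (0 : R).
  suff : \sum_(i <- S) rnorm (u k i - l i) * rnorm (psi (lp_delta p1 i))
      @[k --> \oo] --> \sum_(i <- S) (0 : R) by rewrite big1_eq.
  apply: cvg_big; first exact: add_continuous.
  by move=> i _; rewrite -(mul0r (rnorm (psi (lp_delta p1 i)))); apply: cvgMl.
have e2 : 0 < e / 2 by rewrite divr_gt0.
have /cvgr0Pnorm_lt/(_ _ e2) := cS; apply: filterS => k.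
rewrite ger0_norm; last first.
  by apply: sumr_ge0 => i _; rewrite mulr_ge0 ?rnorm_ge0.
move=> small; rewrite ger0_norm ?rnorm_ge0//.
pose v := u k - l; pose w := lp_comb p1 S v.
have vw : rnorm (psi (v - w)) <= e / 2.
  apply: (le_trans (SP _ _)) => [i iS|].
    by rewrite [LHS](_ : _ = v i - w i)// lp_combE iS subrr.
  rewrite -mulrA ger_pMr// mulrC ler_pdivrMr// mul1r lerD2l.
  rewrite lerXn2r ?nnegrE ?rnorm_ge0// ?(le_trans (rnorm_ge0 _) (uD k))//.
  apply: le_trans (uD k); apply: rnorm_lp_mono => i.
  rewrite [X in rnorm X](_ : _ = v i - w i)// lp_combE.
  by case: ifP; rewrite ?subrr ?subr0// rnorm0 rnorm_ge0.
have -> : psi (u k) - psi l = psi (v - w) + psi w.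
  by rewrite -linearD subrK linearB.
apply: le_lt_trans (rnormD _ _) _; rewrite (splitr e) ler_ltD//.
apply: le_lt_trans small; rewrite linear_lp_comb.
by apply: (le_trans (rnorm_sum _ _ _)); apply: ler_sum => i _; rewrite rnormM.
Qed.

End WeakConvergence.

(** * Finite kernel combinations *)

Lemma countable_setU (T : Type) (A B : set T) :
  countable A -> countable B -> countable (A `|` B).
Proof.
move=> cA cB.
have -> : A `|` B = \bigcup_(b in [set: bool]) (if b then A else B).
  apply/seteqP; split => [t [At|Bt]|t [[] _ ?]].
  - by exists true.
  - by exists false.
  - by left.
  - by right.
by apply: bigcup_countable => // -[].
Qed.

(** Supports are countable subsets of [X], whereas [A3] speaks of families indexed by a [countType];
    this lemma passes from one to the other. *)
Lemma countable_enum (T : choiceType) (A : set T) : countable A ->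
  exists (J : countType) (x : J -> T), injective x /\ range x = A.
Proof.
move=> cA.
have [J JE] : {J : countType | set_type A = J :> Type}.
  apply: choicePcountable; move/countable_injP : cA => [f f_inj].
  apply/countable_injP; exists (f \o val) => a b _ _ /f_inj ab.
  by apply/val_inj/ab; exact: valP.
(* The enumeration is built on [set_type A] and then transported along the type equality [JE]. *)
have : exists x : set_type A -> T, injective x /\ range x = A.
  exists val; split; first exact: val_inj.
  apply/seteqP; split => [_ [a _ <-]|t At]; first exact: set_valP.
  by exists (SigSub (mem_set At)).
by rewrite JE => xP; exists J.
Qed.

Section FiniteCombinations.
Variables (R : realType) (X : choiceType) (m : nat) (x : 'I_m -> X).
Hypothesis x_inj : injective x.

Let S : {fset X} := [fset x j | j in 'I_m]%fset.

Let mem_S j : x j \in S.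
Proof. by apply/imfsetP; exists j. Qed.

Lemma big_fset_nodes (V : Type) (idx : V) (op : Monoid.com_law idx)
    (u : X -> V) :
  \big[op/idx]_(t <- S) u t = \big[op/idx]_(j < m) u (x j).
Proof.
by rewrite big_imfset/= ?big_enum// => i j _ _; exact: x_inj.
Qed.

(** The partial sums are constant as soon as the finite set contains all nodes. *)
Lemma has_sum_nodes (W : normedModType R[i]) (u : X -> W) :
  (forall t, ~ range x t -> u t = 0) -> has_sum u (\sum_(j < m) u (x j)).
Proof.
move=> u0 B /nbhs_singleton sB; exists S => // F /= SF.
rewrite -(big_fset_incl _ SF) ?big_fset_nodes// => t _ tS.
by apply: u0 => -[j _ xj]; rewrite -xj mem_S in tS.
Qed.

Lemma esum_nodes (u : X -> R) : (forall t, 0 <= u t) ->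
  (forall t, ~ range x t -> u t = 0) ->
  (\esum_(t in [set: X]) (u t)%:E)%E = (\sum_(j < m) u (x j))%:E.
Proof.
move=> u_ge0 u0.
transitivity (\esum_(t in [set` S]) (u t)%:E)%E.
  rewrite [RHS]esum_mkcond; apply: eq_esum => t _.
  case: ifPn => // /negP tS; rewrite u0// => -[j _ xj].
  by apply: tS; rewrite -xj inE /= mem_S.
rewrite esum_fset => [||t _]; rewrite ?lee_fin//.
by rewrite fsbig_finite//= set_fsetK sumEFin big_fset_nodes.
Qed.

Lemma nodes_extension (V : nmodType) (c : 'I_m -> V) :
  exists C : X -> V, (forall j, C (x j) = c j) /\
    (forall t, ~ range x t -> C t = 0).
Proof.
(* By injectivity the sum has at most one term, and it is empty off the nodes. *)
exists (fun t => \sum_(j < m | x j == t) c j); split => [j|t tx].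
  rewrite (big_pred1 j)// => i; exact: (inj_eq x_inj).
by rewrite big_pred0// => j; apply/negP => /eqP xj; apply: tx; exists j.
Qed.

End FiniteCombinations.

(** If [G] contains the preimage of [F], then the points of [F] outside the image of [G] lie off the
    range of [x]. Hence the sum over [G] equals a sum over a finite superset of [F]. *)
Lemma has_sum_reindex (R : realType) (X J : choiceType) (W : normedModType R[i])
    (x : J -> X) (u : X -> W) (s : W) : injective x ->
  (forall t, ~ range x t -> u t = 0) -> has_sum u s ->
  has_sum (fun j => u (x j)) s.
Proof.
move=> x_inj u0 us B /us [F _ FB].
have fF : finite_set (x @^-1` [set` F]).
  by apply: finite_preimage => // i j _ _; exact: x_inj.
exists (fset_set (x @^-1` [set` F])) => // G /= FG.
have -> : \sum_(j <- G) u (x j) = \sum_(t <- (F `|` x @` G)%fset) u t.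
  transitivity (\sum_(t <- (x @` G)%fset) u t).
    by rewrite big_imfset//= => i j _ _; exact: x_inj.
  apply: big_fset_incl; first exact: fsubsetUr.
  move=> t; rewrite inE => /orP[tF tG|-> //]; apply: u0 => -[j _ xj].
  move/negP: tG; apply; rewrite -xj; apply/imfsetP; exists j => //=.
  by apply: (fsubsetP FG); rewrite in_fset_set// inE/= xj.
by apply: FB; exact: fsubsetUl.
Qed.

Lemma has_sumB (R : realType) (I : choiceType) (W : normedModType R[i])
    (u v : I -> W) (a b : W) : has_sum u a -> has_sum v b ->
  has_sum (fun i => u i - v i) (a - b).
Proof.
move=> ua vb B abB.
pose S (w : I -> W) (F : {fset I}) := \sum_(i <- F) w i.
have [F0 _ F0B] : nbhs (S u F - S v F @[F --> @summability.totally I]) B.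
  have FF : Filter (@summability.totally I) := summability.totally_filter.
  exact: (@cvgB _ W _ _ FF (S u) (S v) a b ua vb B abB).
exists F0 => // F /F0B; rewrite /preimage/=; congr (B _).
by rewrite /S -sumrB.
Qed.

(** * Uniqueness of coefficients and the norm of kernel combinations *)

Section Representation.
Variables (R : realType) (X : pointedType) (V W : normedModType R[i]).
Variable K : X -> X -> bounded_op V W.
Hypothesis hA3 : A3 K.

(** The difference [c - d], enumerated along the union of the two countable supports, is an
    absolutely summable family with zero kernel sum, so [A3] makes it vanish. *)
Lemma represents_inj (c d : X -> V) f :
  represents K c f -> represents K d f -> c = d.
Proof.
move=> [cc cfin cf] [dc dfin df].
have [J [x [x_inj xA]]] := countable_enum (countable_setU cc dc).
have off t : ~ range x t -> c t - d t = 0.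
  rewrite xA => /not_orP[/negP/negPn/eqP-> /negP/negPn/eqP->].
  by rewrite subrr.
suff cd0 j : c (x j) - d (x j) = 0.
  apply/funext => t; apply/eqP; rewrite -subr_eq0; apply/eqP.
  by have [[j _ <-]|/off] := pselect (range x t).
move: j; apply: (hA3 x_inj) => [|t].
  pose g t := ((rnorm (c t))%:E + (rnorm (d t))%:E)%E.
  have gfin : (\esum_(t in [set: X]) g t < +oo)%E.
    by rewrite esumD ?lte_add_pinfty// => *; rewrite lee_fin rnorm_ge0.
  apply: le_lt_trans gfin.
  (* Summability transfers from [X] to [J]: the norm of a difference is at most [g], and the sum of
     [g] over the range of [x] is at most its sum over [X]. *)
  apply: (@le_trans _ _ (\esum_(j in [set: J]) g (x j))%E).
    apply: le_esum => j _; rewrite /g -EFinD lee_fin (le_trans (rnormD _ _))//.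
    by rewrite rnormN.
  rewrite -(esum_image setT x) => [|i j _ _]; last exact: x_inj.
  rewrite [leLHS]esum_mkcond; apply: le_esum => t _.
  by case: ifP => // _; rewrite adde_ge0// lee_fin rnorm_ge0.
apply: (@has_sum_reindex _ _ _ _ x (fun s => K s t (c s - d s))) => //.
  by move=> s /off ->; rewrite linear0.
rewrite -(subrr (f t)); have := has_sumB (cf t) (df t).
by congr (has_sum _ _); apply/funext => s; rewrite linearB.
Qed.

Lemma BKcoefE (c : X -> V) f : represents K c f -> BKcoef K f = c.
Proof.
by move=> cf; apply: xget_unique => // d df; exact: represents_inj df cf.
Qed.

Variables (m : nat) (x : 'I_m -> X).
Hypothesis x_inj : injective x.

(** Members of [span_at] have this form by definition, and the value at [x k] is convertible to
    [opmx_app (kernel_mx K x) c k]. *)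
Definition kernel_comb (c : 'I_m -> V) : X -> W :=
  fun t => \sum_(j < m) K (x j) t (c j).

Lemma represents_kernel_comb (c : 'I_m -> V) : exists C : X -> V,
  [/\ represents K C (kernel_comb c), forall j, C (x j) = c j &
     forall t, ~ range x t -> C t = 0].
Proof.
have [C [Cx C0]] := nodes_extension x_inj c; exists C; split => //; split.
- apply: (@sub_countable _ _ _ (range x)); last first.
    by apply: sub_countable (card_image_le _ _) _; exact: countableP.
  apply: subset_card_le => t /eqP Ct; apply: contrapT => /C0; exact: Ct.
- rewrite (esum_nodes x_inj) ?ltry// => [t|t /C0 ->]; first exact: rnorm_ge0.
  exact: rnorm0.
- move=> t; rewrite /kernel_comb; under eq_bigr do rewrite -Cx.
  apply: (has_sum_nodes x_inj (u := fun s => K s t (C s))) => s /C0 ->.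
  exact: linear0.
Qed.

Lemma BK_kernel_comb c : BK K (kernel_comb c).
Proof. by have [C [CK _ _]] := represents_kernel_comb c; exists C. Qed.

Lemma BKnorm_kernel_comb c :
  BKnorm K (kernel_comb c) = \sum_(j < m) rnorm (c j).
Proof.
have [C [CK Cx C0]] := represents_kernel_comb c.
rewrite /BKnorm (BKcoefE CK) (esum_nodes x_inj)/= => [||t /C0 ->].
- by apply: eq_bigr => j _; rewrite Cx.
- by move=> t; exact: rnorm_ge0.
- exact: rnorm0.
Qed.

End Representation.

(** * Existence of a minimizer *)

Lemma cvg_of_rnorm (R : realType) (V : normedModType R[i])
    (u : nat -> V) (l : V) :
  rnorm (u k - l) @[k --> \oo] --> (0 : R) -> u k @[k --> \oo] --> l.
Proof.
move=> ul; apply/cvgrPdist_lt => e e0.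
(* A positive element of [R[i]] has zero imaginary part. *)
have eE : e = (complex.Re e)%:C%C.
  by case: e e0 => a b; rewrite ltcE/= => /andP[/eqP-> _].
rewrite eE ltcR in e0; have /cvgr0Pnorm_lt/(_ _ e0) := ul.
apply: filterS => k; rewrite ger0_norm ?rnorm_ge0// => uk.
by rewrite eE distrC -rnormK ltcR.
Qed.

Lemma bounded_op_ge0 (R : realType) (V W : normedModType R[i])
    (T : bounded_op V W) :
  exists M : R, 0 <= M /\ forall v, rnorm (T v) <= M * rnorm v.
Proof.
have [M TM] := bop_bounded T; exists `|M|; split => // v.
by apply: le_trans (TM v) _; rewrite ler_wpM2r ?rnorm_ge0 ?ler_norm.
Qed.

Lemma lp_coord_le (R : realType) (I : choiceType) (p : \bar R) (p1 : (1 <= p)%E)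
    (u : lp I p1) i : rnorm (u i) <= rnorm u.
Proof.
have /lpnormr_leP := lexx (rnorm u); move=> /(_ (rnorm_ge0 u)).
move: (rnorm u) (rnorm_ge0 u) (lpval u) => a a0 v.
case: p p1 {u} => [r|_|//].
  rewrite lee_fin => r1; rewrite lpnorm_ryP// => /(_ [fset i]%fset).
  have r0 : 0 < r by exact: lt_le_trans r1.
  rewrite big_seq_fset1 => h; rewrite leNgt; apply/negP => av.
  by move: h; rewrite leNgt gt0_ltr_powR ?nnegrE ?rnorm_ge0.
by rewrite lpnorm_yP.
Qed.

Section Minimizer.
Variables (R : realType) (I : countType) (p : \bar R) (p1 : (1 <= p)%E).
Local Notation V := (lp I p1).
Hypothesis pI : p = 2%:E \/ exists S : {fset I}, forall i, i \in S.
Variables (W : normedModType R[i]) (m : nat).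
Variable A : 'I_m -> 'I_m -> bounded_op V W.

(** Composing [phi] with the columns of [A] turns it into a finite sum of bounded functionals of the
    blocks of [c], plus a constant depending on [y]; weak convergence in l^p then applies to each
    block. *)
Lemma opmx_weak_cvg (y : 'I_m -> W) (c : nat -> 'I_m -> V) (c0 : 'I_m -> V)
    (C : R) :
  (forall k j, rnorm (c k j) <= C) ->
  (forall j i, rnorm (c k j i - c0 j i) @[k --> \oo] --> (0 : R)) ->
  weakly_converges (fun k => (opmx_app A (c k), y)) (opmx_app A c0, y).
Proof.
move=> cC cc0 phi [M phiM]; apply: cvg_of_rnorm.
pose psi j (v : V) : R[i]^o := phi (fun i => A i j v, 0).
have psi_lin j : linear (psi j).
  move=> a u v; rewrite /psi -linearP; congr (phi _); congr pair; last first.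
    by rewrite /= scaler0 addr0.
  by apply/funext => i; rewrite linearP.
pose Psi j : {linear V -> R[i]^o} :=
  HB.pack (psi j) (GRing.isLinear.Build _ _ _ _ (psi j) (psi_lin j)).
have psi_sum c' :
    phi (opmx_app A c', y) = \sum_(j < m) Psi j (c' j) + phi (0, y).
  rewrite -linear_sum/= -linearD; congr (phi _).
  have E (f : 'I_m -> 'I_m -> W) :
      \sum_(j < m) (f j, 0 : 'I_m -> W) = (\sum_(j < m) f j, 0).
    by elim/big_rec2 : _ => // j a b _ ->; congr pair; rewrite addr0.
  rewrite E; congr pair; rewrite ?addr0 ?add0r//.
  by apply/funext => i; rewrite /opmx_app fct_sumE.
have PsiB j : exists N : R, 0 <= N /\ forall v, rnorm (Psi j v) <= N * rnorm v.
  have [N NP] := choice (fun i => bounded_op_ge0 (A i j)).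
  (* The bounds of the entries of column [j] are summed; [M] itself may be negative. *)
  exists (`|M| * \sum_(i < m) N i); split.
    by rewrite mulr_ge0// sumr_ge0// => i _; case: (NP i).
  move=> v; apply: le_trans (phiM _) _ => /=.
  rewrite [X in _ + X]big1 => [|i _]; last exact: rnorm0.
  rewrite addr0 -mulrA mulr_suml.
  apply: (@le_trans _ _ (`|M| * \sum_(i < m) rnorm (A i j v))).
    by rewrite ler_wpM2r ?ler_norm// sumr_ge0// => i _; exact: rnorm_ge0.
  by rewrite ler_wpM2l// ler_sum// => i _; case: (NP i).
have lim j : rnorm (Psi j (c k j) - Psi j (c0 j)) @[k --> \oo] --> (0 : R).
  have [N [N0 PN]] := PsiB j.
  by apply: (lp_weak_cvg N0 PN pI (C := C)) => // i; exact: cc0.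
have lim0 : \sum_(j < m) rnorm (Psi j (c k j) - Psi j (c0 j))
    @[k --> \oo] --> (0 : R).
  suff : \sum_(j < m) rnorm (Psi j (c k j) - Psi j (c0 j))
    @[k --> \oo] --> \sum_(j < m) (0 : R) by rewrite big1_eq.
  by apply: cvg_big => //; exact: add_continuous.
apply: (squeeze_cvgr _ (cvg_cst 0) lim0); apply: nearW => k.
rewrite rnorm_ge0/= !psi_sum opprD addrACA subrr addr0 -sumrB.
exact: rnorm_sum.
Qed.

Lemma exists_minimizer (L : ('I_m -> W) * ('I_m -> W) -> R) (lambda : R)
    (y : 'I_m -> W) : (forall z, 0 <= L z) -> completely_continuous L ->
  0 < lambda -> exists c0 : 'I_m -> V, forall c : 'I_m -> V,
    L (opmx_app A c0, y) + lambda * \sum_(j < m) rnorm (c0 j) <=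
    L (opmx_app A c, y) + lambda * \sum_(j < m) rnorm (c j).
Proof.
move=> L0 Lcc lambda0.
pose F c := L (opmx_app A c, y) + lambda * \sum_(j < m) rnorm (c j).
pose E := [set F c | c in [set: 'I_m -> V]].
have F0 c : 0 <= F c.
  rewrite addr_ge0// mulr_ge0 ?(ltW lambda0)// sumr_ge0// => j _.
  exact: rnorm_ge0.
have lbE : lbound E 0 by move=> _ [c _ <-].
have infE : has_inf E.
  by split; [exists (F (fun=> 0)); exists (fun=> 0)|exists 0].
have ex k : exists c, F c < inf E + k.+1%:R^-1.
  have k0 : 0 < (k.+1%:R^-1 : R) by [].
  by have [_ [c _ <-] cE] := inf_adherent k0 infE; exists c.
have [c cP] := choice ex.
(* The loss is nonnegative, so [lambda] times the total norm is at most [F (c k) <= inf E + 1]. *)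
pose C := (inf E + 1) / lambda.
have cC k j : rnorm (c k j) <= C.
  apply: (@le_trans _ _ (\sum_(i < m) rnorm (c k i))).
    by rewrite (bigD1 j)//= lerDl sumr_ge0// => i _; exact: rnorm_ge0.
  rewrite /C ler_pdivlMr// mulrC.
  apply: le_trans (_ : F (c k) <= _); first by rewrite lerDr.
  by apply: le_trans (ltW (cP k)) _; rewrite lerD2l invf_le1 ?ler1n.
(* The norms of the blocks are added to the coordinates, so that they converge
   along the same subsequence. *)
pose T : countType := ('I_m + ('I_m * I) * bool)%type.
pose u k (t : T) : R := match t with
  | inl j => rnorm (c k j)
  | inr (j, i, b) => if b then complex.Re (c k j i) else complex.Im (c k j i)
  end.
have [|s [l [sk ul]]] := @pointwise_bounded_subsequence R T (fun=> C) u.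
  move=> k [j|[[j i] b]] /=; first by rewrite ger0_norm ?rnorm_ge0.
  have [hre him] := ReIm_le_rnorm (c k j i).
  have := le_trans (lp_coord_le (c k j) i) (cC k j).
  by case: b; exact: le_trans.
pose c0val j i : R[i]^o := (l (inr (j, i, true)) +i* l (inr (j, i, false)))%C.
have coord j i : rnorm (c (s k) j i - c0val j i) @[k --> \oo] --> (0 : R).
  apply: cvg_rnorm_ReIm; first exact: (ul (inr (j, i, true))).
  exact: (ul (inr (j, i, false))).
(* The norms of the blocks converge to [l (inl j)], so the coordinatewise limit has finite p-norm
   and defines an element of l^p. *)
have c0le j : (lpnorm p (c0val j) <= (l (inl j))%:E)%E.
  apply: (lpnorm_lsc p1 (u := fun k => lpval (c (s k) j))
    (a := fun k => rnorm (c (s k) j))) => [k|k|i|].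
  - exact: rnorm_ge0.
  - by apply/lpnormr_leP => //; exact: rnorm_ge0.
  - exact: cvg_rnorm (coord j i).
  - exact: (ul (inl j)).
have c0P j : c0val j \in lp_pred p1.
  by rewrite inE/=; apply: le_lt_trans (c0le j) _; rewrite ltry.
pose c0 j : V := Lp (c0P j).
have nc0 j : rnorm (c0 j) <= l (inl j).
  by apply: (lp_lsc (u := fun k => c (s k) j)) => //; exact: (ul (inl j)).
have Llim : L (opmx_app A (c (s k)), y) @[k --> \oo] --> L (opmx_app A c0, y).
  by apply: Lcc; apply: (opmx_weak_cvg (C := C)) => // k j; exact: cC.
have Flim : F (c (s k)) @[k --> \oo] -->
    L (opmx_app A c0, y) + lambda * \sum_(j < m) l (inl j).
  apply: cvgD => //; apply: cvgMr; apply: cvg_big; first exact: add_continuous.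
  by move=> j _; exact: (ul (inl j)).
have Elim : inf E + k.+1%:R^-1 @[k --> \oo] --> inf E.
  rewrite -[X in _ --> X]addr0; apply: cvgD; first exact: cvg_cst.
  exact: cvg_harmonic.
have FE : L (opmx_app A c0, y) + lambda * \sum_(j < m) l (inl j) <= inf E.
  apply: (ler_cvg_to Flim Elim); apply: nearW => k.
  (* The index [s k] is at least [k], so the error [1/(s k + 1)] is at most [1/(k + 1)]. *)
  apply: le_trans (ltW (cP _)) _; rewrite lerD2l lef_pV2 ?posrE// ler_nat ltnS.
  exact: sk.
exists c0 => c'; apply: le_trans (_ : inf E <= _); last first.
  by apply: inf_lbound; [exists 0|exists c'].
by apply: le_trans FE; rewrite lerD2l ler_pM2l// ler_sum.
Qed.

End Minimizer.

(** * The relaxed representer inequality *)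

Lemma calB_index_cases (R : realType) (p : \bar R) (n : nat) :
  p = 2%:E \/ exists S : {fset calB_index p n}, forall i, i \in S.
Proof.
rewrite /calB_index; case: eqP => [->|_]; [by left|right].
by exists [fset i | i in 'I_n]%fset => i; apply/imfsetP; exists i.
Qed.

(** Attainment on the span is part of the conclusion, through the minimizer [f0]; the minimum over
    [BK] and those in [hbeta] are infima in the extended reals. *)
Theorem lemma6p1 (R : realType) (n : nat) (p q : \bar R)
    (p1 : (1 <= p)%E) (q1 : (1 <= q)%E) (pq : (p^-1 + q^-1 = 1)%E)
    (X : pointedType)
    (K : X -> X -> bounded_op (calB n p1) (calB n q1))
    (hA1 : A1 K) (hA2 : A2 K) (hA3 : A3 K)
    (m : nat) (x : 'I_m -> X) (x_inj : injective x)
    (beta : R) (beta1 : 1 <= beta)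
    (hbeta : forall y : 'I_m -> calB n q1,
      ((beta^-1)%:E * inf_norm K (interpolants K x y `&` span_at K x)
        <= inf_norm K (interpolants K x y))%E)
    (L : ('I_m -> calB n q1) * ('I_m -> calB n q1) -> R)
    (hL : is_loss L) (hLcc : completely_continuous L)
    (lambda : R) (lambda0 : 0 < lambda) (y : 'I_m -> calB n q1) :
  exists f0, [/\ span_at K x f0,
    forall f, span_at K x f ->
      objective K x L y lambda f0 <= objective K x L y lambda f &
    ((objective K x L y lambda f0)%:E <=
      ereal_inf [set (objective K x L y (lambda * beta) f)%:E | f in BK K])%E].
Proof.
have [c0 c0min] := exists_minimizer (calB_index_cases p n) (kernel_mx K x) y
  hL.1 hLcc lambda0.
pose comb := kernel_comb K x.
have objE mu c : objective K x L y mu (comb c) =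
    L (opmx_app (kernel_mx K x) c, y) + mu * \sum_(j < m) rnorm (c j).
  by rewrite /objective BKnorm_kernel_comb.
exists (comb c0); split => [|_ [c ->]|]; first by exists c0.
  by have := c0min c; rewrite -!objE.
apply: le_ereal_inf_tmp => _ [f BKf <-]; rewrite lee_fin.
have [Minv [KMinv MinvK]] := hA1 _ _ x_inj.
pose z := sample x f; pose c := opmx_app Minv z.
apply: le_trans (_ : objective K x L y lambda (comb c) <= _).
  by have := c0min c; rewrite -!objE.
(* The right inverse in [A1] makes [comb c] an interpolant of the values of [f], so both objectives
   have the same loss term. *)
have zc : sample x (comb c) = z by exact: MinvK.
rewrite /objective zc lerD2l -mulrA ler_pM2l// mulrC.
rewrite -ler_pdivrMr ?(lt_le_trans _ beta1)// mulrC -lee_fin EFinM.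
apply: le_trans (_ : ((beta^-1)%:E *
    inf_norm K (interpolants K x z `&` span_at K x) <= _)%E).
  rewrite lee_wpmul2l ?lee_fin ?invr_ge0 ?(le_trans _ beta1)//.
  (* The left inverse in [A1] forces the coefficients of any interpolant in the span to be [c], so
     the infimum is bounded below by the norm of [comb c]. *)
  apply: le_ereal_inf_tmp => _ [g [[_ gz] [d gd]] <-]; rewrite {g}gd in gz *.
  suff -> : d = c by [].
  by apply: etrans (esym (KMinv d)) _; rewrite /c -gz.
(* The function [f] is itself one of the interpolants of [z]. *)
apply: le_trans (hbeta z) _; apply: ereal_inf_lbound.
by exists f.
Qed.
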